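(* Let $n\ge3$, $n\ne4$. The biharmonic potential of the Gaussian has the representation $$\mathcal B_n(e^{-|\cdot|^2})(\mathbf x)=\frac{1}{4(n-2)(n-4)}\;{}_1F_1\Big(\frac{n-4}{2},\frac n2,-|\mathbf x|^2\Big),\qquad \mathbf x\in\mathbb R^n,$$ where ${}_1F_1$ denotes the Kummer (confluent hypergeometric) function.
   Context: For $n\ge3$, $n\neq4$, the biharmonic potential is $$\mathcal B_n f(\mathbf x)=\frac{\Gamma(n/2)}{4\pi^{n/2}(n-2)(n-4)}\int_{\mathbb R^n}\frac{f(\mathbf y)}{|\mathbf x-\mathbf y|^{n-4}}\,d\mathbf y,\qquad \mathbf x\in\mathbb R^n .$$ The Kummer function is ${}_1F_1(a,c,z)=\sum_{k\ge0}\frac{(a)_k}{(c)_k}\frac{z^k}{k!}$, with $(a)_k=a(a+1)\cdots(a+k-1)$. *)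

(* Defs.v *)
From HB Require Import structures.
From mathcomp Require Import all_boot all_order all_algebra.
From mathcomp Require Import all_classical all_reals all_analysis.

Set Implicit Arguments.
Unset Strict Implicit.
Unset Printing Implicit Defensive.
Import Order.TTheory GRing.Theory Num.Theory.
Import numFieldNormedType.Exports.
Local Open Scope classical_set_scope.
Local Open Scope ring_scope.

Definition tcons (T : Type) (n : nat) (p : T * n.-tuple T) : n.+1.-tuple T :=
  [tuple of p.1 :: p.2].

Lemma measurable_tcons d (T : measurableType d) (n : nat) :
  measurable_fun setT (@tcons T n).
Proof. exact: measurable_cons. Qed.

(* The product measure mu \x ... \x mu (n factors), on the product
   sigma-algebra that the library puts on tuples; it is determined by
   [power_measure_box] below. *)
Section power_measure.
Context d (T : measurableType d) (R : realType).
Variable mu : set T -> \bar R.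

Fixpoint power_measure (n : nat) : set (n.-tuple T) -> \bar R :=
  match n with
  | 0 => \d_ [tuple]
  | m.+1 => pushforward (mu \x @power_measure m)%E (@tcons T m)
  end.

End power_measure.
Arguments power_measure {d T R} mu n : rename.

Section power_measure_theory.
Context d (T : measurableType d) (R : realType).
Variable mu : {sigma_finite_measure set T -> \bar R}.

Section step.
Variables (n : nat) (m : {sigma_finite_measure set (n.-tuple T) -> \bar R}).

Let sigma_finite_prod : sigma_finite setT (mu \x m)%E.
Proof.
have /sigma_finiteP[F [FT ndF Foo]] := sigma_finiteT mu.
have /sigma_finiteP[G [GT ndG Goo]] := sigma_finiteT m.
exists (fun k => F k `*` G k).
  rewrite -setXTT FT GT predeqE => -[x y]; split.
    move=> [/= [i _ Fix] [j _ Gjy]]; exists (maxn i j) => //; split.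
      by move: x Fix; exact/subsetPset/ndF/leq_maxl.
    by move: y Gjy; exact/subsetPset/ndG/leq_maxr.
  by move=> [k _ []/= ? ?]; split; exists k.
move=> k; have [? ?] := Foo k; have [? ?] := Goo k.
split; first exact: measurableX.
by rewrite product_measure1E// lte_mul_pinfty// ge0_fin_numE.
Qed.

Lemma sigma_finite_pushforward_tcons :
  sigma_finite setT (pushforward (mu \x m)%E (@tcons T n)).
Proof.
have [F FT Foo] := sigma_finite_prod.
pose uncons (t : n.+1.-tuple T) : T * n.-tuple T :=
  (thead t, [tuple of behead t]).
have unK : cancel (@tcons T n) uncons.
  by case=> x t; rewrite /uncons /tcons /= theadE; congr pair; exact/val_inj.
have muncons : measurable_fun setT uncons.
  apply/measurable_fun_pairP; split => /=.
    exact: measurable_tnth.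
  exact: measurable_behead.
exists (fun k => uncons @^-1` F k).
  by rewrite -preimage_bigcup -FT preimage_setT.
move=> k; have [mF Fk] := Foo k; split.
  by rewrite -[X in measurable X]setTI; exact: muncons.
rewrite /pushforward -comp_preimage.
by rewrite (_ : uncons \o _ = id) ?preimage_id//; apply/funext => p /=; rewrite unK.
Qed.

End step.

Lemma power_measure_subproof (n : nat) :
  {m : {sigma_finite_measure set (n.-tuple T) -> \bar R} |
    power_measure mu n = m :> (set _ -> _)}.
Proof.
elim: n => [|n [m mE]]; first by exists (\d_ ([tuple] : 0.-tuple T)).
pose p : {measure set _ -> \bar R} := measure_function_pushforward__canonical__measure_function_Measure (mu \x m)%E (@measurable_tcons d T n).
pose p1 := Measure_isSigmaFinite.Build _ _ _ p (sigma_finite_pushforward_tcons m).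
pose p2 : {sigma_finite_measure set _ -> \bar R} := HB.pack (Measure.sort p) p1.
by exists p2; rewrite /= mE.
Qed.

Let power_measure0 n : power_measure mu n set0 = 0%E.
Proof. by have [m ->] := power_measure_subproof n; rewrite measure0. Qed.

Let power_measure_ge0 n A : (0 <= power_measure mu n A)%E.
Proof. by have [m ->] := power_measure_subproof n; exact: measure_ge0. Qed.

Let power_measure_sigma_additive n : semi_sigma_additive (power_measure mu n).
Proof.
have [m ->] := power_measure_subproof n.
exact: measure_semi_sigma_additive.
Qed.

Let power_measure_sigma_finite n : sigma_finite setT (power_measure mu n).
Proof. by have [m ->] := power_measure_subproof n; exact: sigma_finiteT. Qed.

HB.instance Definition _ (n : nat) := isMeasure.Build _ _ _ (power_measure mu n)
  (@power_measure0 n) (@power_measure_ge0 n) (@power_measure_sigma_additive n).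

HB.instance Definition _ (n : nat) :=
  Measure_isSigmaFinite.Build _ _ _ (power_measure mu n)
    (@power_measure_sigma_finite n).

Lemma power_measure_box (n : nat) (A : 'I_n -> set T) :
  (forall i, measurable (A i)) ->
  power_measure mu n [set t | forall i, A i (tnth t i)] =
  (\prod_(i < n) mu (A i))%E.
Proof.
elim: n A => [|n IHn] A mA.
  by rewrite big_ord0 /= diracE mem_set// => -[].
rewrite big_ord_recl -IHn; last by move=> i; exact: mA.
have [m mE] := power_measure_subproof n.
rewrite /= /pushforward mE.
pose B := [set t : n.-tuple T | forall i, A (lift ord0 i) (tnth t i)].
rewrite -/B.
have mB : measurable B.
  rewrite (_ : B = (\bigcap_(i in [set: 'I_n])
      ((fun t : n.-tuple T => tnth t i) @^-1` A (lift ord0 i)))%classic).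
    apply: fin_bigcap_measurable; first exact: finite_finset.
    move=> i _; rewrite -[X in measurable X]setTI.
    exact: measurable_tnth.
  by apply/seteqP; split=> t /= Bt i; [move=> _|]; exact: Bt.
rewrite -product_measure1E//; congr (product_measure1 _ _ _).
apply/seteqP; split=> -[x t] /=.
  move=> At; split; first by have := At ord0; rewrite tnth0.
  by move=> i; have := At (lift ord0 i); rewrite tnthS.
move=> [Ax Bt] i; have [->|] := eqVneq i ord0; first by rewrite tnth0.
by rewrite eq_sym => /unlift_some[j -> _]; rewrite tnthS; exact: Bt.
Qed.

End power_measure_theory.

Definition lebesgue_measure_Rn (R : realType) (n : nat) :
  set (n.-tuple (measurableTypeR R)) -> \bar R :=
  power_measure lebesgue_measure n.
Arguments lebesgue_measure_Rn : clear implicits.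

HB.instance Definition _ (R : realType) (n : nat) :=
  SigmaFiniteMeasure.copy (lebesgue_measure_Rn R n)
    (power_measure (@lebesgue_measure R) n).

Definition euclidean_norm (R : realType) (n : nat) (x : n.-tuple R) : R :=
  Num.sqrt (\sum_(i < n) tnth x i ^+ 2).

Definition euclidean_dist (R : realType) (n : nat) (x y : n.-tuple R) : R :=
  euclidean_norm [tuple tnth x i - tnth y i | i < n].

(* Euler's integral; it is Gamma(s) for s > 0. *)
Definition Gamma (R : realType) (s : R) : R :=
  \int[lebesgue_measure]_(t in `]0%R, +oo[) (t `^ (s - 1) * expR (- t)).

(* The potential is extended-real valued: a finite value (with a nonnegative
   density) therefore includes the absolute convergence of the integral.  The
   exponent n - 4 is an integer, negative for n = 3.  The value of the kernel
   at y = x (where 0 ^-1 = 0) is immaterial, since points are negligible. *)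
Definition biharmonic_potential (R : realType) (n : nat) (f : n.-tuple R -> R)
    (x : n.-tuple R) : \bar R :=
  ((Gamma (n%:R / 2) / (4 * pi `^ (n%:R / 2) * (n%:R - 2) * (n%:R - 4)))%:E *
   \int[lebesgue_measure_Rn R n]_y (f y / euclidean_dist x y ^ (n%:Z - 4))%:E)%E.

Definition pochhammer (R : realType) (a : R) (k : nat) : R :=
  \prod_(i < k) (a + i%:R).

(* The sum of the power series in z, which converges for all z as soon as c is
   not one of 0, -1, -2, ... *)
Definition kummer (R : realType) (a c z : R) : R :=
  limn (series (fun k : nat =>
    pochhammer a k / pochhammer c k * (z ^+ k / k`!%:R))).

(* Main.v *)
(* Write c = n/2, r = |x - y| and u = s/(1 + s).  Euler's integral gives
     Gamma(c) r^(4-n) = \int_0^oo s^(c-1) r^4 exp(-s r^2) ds,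
   where the exponent n/2 rather than (n-4)/2 keeps the integrand continuous
   at 0 also for n = 3.  By Tonelli's theorem the potential becomes the integral
   of s^(c-1) M_2(s), where M_k(s) is the integral of
   r^(2k) exp(-|y|^2 - s r^2) in y.  M_0 factors into one-dimensional Gaussian
   integrals and equals pi^c (1-u)^c exp(-u |x|^2), and M_2 is its second
   derivative, by differentiation under the integral sign.  Finally the factor
   exp(-u |x|^2) is expanded into its power series, which is integrated term by
   term against the measure u^(c-1) (1-u)^m du, by dominated convergence. *)

Require Import Defs.
From mathcomp Require Import all_boot all_order all_algebra.
From mathcomp Require Import all_classical all_reals all_analysis.
From mathcomp Require Import measurable_realfun.
From mathcomp Require Import ring lra.

Set Implicit Arguments.
Unset Strict Implicit.
Unset Printing Implicit Defensive.
Import Order.TTheory GRing.Theory Num.Theory.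
Import numFieldNormedType.Exports.
Local Open Scope classical_set_scope.
Local Open Scope ring_scope.

(** * Integration against a power measure, one coordinate at a time *)

Section power_measure_integral.
Context d (T : measurableType d) (R : realType).
Variable mu : {sigma_finite_measure set T -> \bar R}.
Local Open Scope ereal_scope.

Lemma integral_power_measure0 (f : 0.-tuple T -> \bar R) :
  measurable_fun setT f -> \int[power_measure mu 0]_t f t = f [tuple].
Proof.
move=> mf; rewrite [LHS](_ : _ = \int[\d_ ([tuple] : 0.-tuple T)]_t f t)//.
by rewrite integral_dirac// diracT mul1e.
Qed.

(** The measure is a pushforward of [mu \x power_measure mu n], so a change of variables and
    Tonelli's theorem peel off the first coordinate. *)
Lemma ge0_integral_power_measureS n (f : n.+1.-tuple T -> \bar R) :
  measurable_fun setT f -> (forall t, 0 <= f t) ->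
  \int[power_measure mu n.+1]_t f t =
  \int[mu]_y \int[power_measure mu n]_t f (tcons (y, t)).
Proof.
move=> mf f0.
rewrite [LHS](_ : _ =
  \int[pushforward (mu \x power_measure mu n) (@tcons T n)]_t f t)//.
rewrite (ge0_integral_pushforward (@measurable_tcons _ T n))//.
rewrite preimage_setT -(fubini_tonelli1 (f \o @tcons T n))//=.
apply: measurableT_comp => //; exact: measurable_tcons.
Qed.

End power_measure_integral.

(** * The one-dimensional Gaussian integral *)

Lemma integral_gauss_mul (R : realType) (s x : R) : 0 <= s ->
  (\int[lebesgue_measure]_y (expR (- (y ^+ 2 + s * (x - y) ^+ 2)))%:E =
   (Num.sqrt (pi / (1 + s)) * expR (- (s / (1 + s) * x ^+ 2)))%:E)%E.
Proof.
move=> s0.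
have s1 : 0 < 1 + s by lra.
(* Completing the square, y^2 + s (x - y)^2 = (1 + s) (y - s x / (1 + s))^2 + s x^2 / (1 + s), shows
   a multiple of the normal density with mean s x / (1 + s) and variance 1 / (2 (1 + s)). *)
pose sg := Num.sqrt ((1 + s) *+ 2)^-1.
have sg2 : sg ^+ 2 *+ 2 = (1 + s)^-1.
  rewrite /sg sqr_sqrtr ?invr_ge0 ?mulrn_wge0 ?ltW//.
  by rewrite -mulr_natr -(mulr_natr (1 + s)) invfM mulfVK.
have sg0 : sg != 0.
  by rewrite gt_eqF// sqrtr_gt0 invr_gt0 mulrn_wgt0.
set C := Num.sqrt _ * _.
transitivity (\int[lebesgue_measure]_y
    (C%:E * (normal_pdf (s / (1 + s) * x) sg y)%:E))%E.
  apply: eq_integral => y _; rewrite -EFinM; congr EFin.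
  rewrite normal_pdfE// /normal_peak /normal_fun sg2.
  rewrite -mulrnAl sg2 /C [(1 + s)^-1 * pi]mulrC.
  set q := Num.sqrt _.
  have q0 : q != 0 by rewrite gt_eqF// sqrtr_gt0 divr_gt0// pi_gt0.
  rewrite mulrACA divff// mul1r -expRD.
  by congr expR; field; rewrite gt_eqF.
rewrite integralZl//; last exact: integrable_normal_pdf.
by rewrite integral_normal_pdf mule1.
Qed.

(** * Gaussian moments M_k(s) of the squared distance *)

Section gaussian_moments.
Context (R : realType).
Implicit Types (n : nat) (s : R).

Definition sqnorm n (y : n.-tuple R) : R := \sum_(i < n) tnth y i ^+ 2.

Definition sqdist n (x y : n.-tuple R) : R :=
  \sum_(i < n) (tnth x i - tnth y i) ^+ 2.

Lemma sqnorm_ge0 n (y : n.-tuple R) : 0 <= sqnorm y.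
Proof. by apply: sumr_ge0 => i _; exact: sqr_ge0. Qed.

Lemma sqdist_ge0 n (x y : n.-tuple R) : 0 <= sqdist x y.
Proof. by apply: sumr_ge0 => i _; exact: sqr_ge0. Qed.

Lemma sqr_euclidean_norm n (y : n.-tuple R) : euclidean_norm y ^+ 2 = sqnorm y.
Proof. by rewrite sqr_sqrtr// sqnorm_ge0. Qed.

Lemma sqr_euclidean_dist n (x y : n.-tuple R) :
  euclidean_dist x y ^+ 2 = sqdist x y.
Proof.
by rewrite sqr_euclidean_norm; apply: eq_bigr => i _; rewrite tnth_mktuple.
Qed.

Lemma measurable_sqnorm n :
  measurable_fun [set: n.-tuple (measurableTypeR R)] (@sqnorm n).
Proof.
apply: measurable_sum => i; apply: measurable_funX.
exact: (@measurable_tnth _ (measurableTypeR R)).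
Qed.

Lemma measurable_sqdist n (x : n.-tuple R) :
  measurable_fun [set: n.-tuple (measurableTypeR R)] (sqdist x).
Proof.
apply: measurable_sum => i; apply: measurable_funX; apply: measurable_funB => //.
exact: (@measurable_tnth _ (measurableTypeR R)).
Qed.

(** The exponent is a sum over the coordinates, so the integral factors, by induction on n. *)
Lemma integral_gauss_mul_Rn s n (x : n.-tuple R) : 0 <= s ->
  (\int[lebesgue_measure_Rn R n]_y (expR (- (sqnorm y + s * sqdist x y)))%:E =
   (Num.sqrt (pi / (1 + s)) ^+ n * expR (- (s / (1 + s) * sqnorm x)))%:E)%E.
Proof.
move=> s0.
have mE m (z : m.-tuple R) : measurable_fun
    [set: m.-tuple (measurableTypeR R)]
    (fun y : m.-tuple (measurableTypeR R) =>
      (expR (- (sqnorm y + s * sqdist z y)))%:E).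
  apply/measurable_EFinP; apply: measurableT_comp => //.
  apply: measurable_funN; apply: measurable_funD.
    exact: measurable_sqnorm.
  by apply: measurable_funM => //; exact: measurable_sqdist.
elim: n x => [|n IHn] x.
  rewrite /lebesgue_measure_Rn integral_power_measure0//.
  by rewrite /sqnorm /sqdist !big_ord0 expr0 !mulr0 addr0 mul1r.
case/tupleP: x => x0 x.
rewrite /lebesgue_measure_Rn ge0_integral_power_measureS//.
have sqnormS m (a : R) (t : m.-tuple R) :
    sqnorm [tuple of a :: t] = a ^+ 2 + sqnorm t.
  rewrite /sqnorm big_ord_recl tnth0; congr (_ + _).
  by apply: eq_bigr => i _; rewrite tnthS.
have sqdistS (a : R) (t : n.-tuple R) :
    sqdist [tuple of x0 :: x] [tuple of a :: t] = (x0 - a) ^+ 2 + sqdist x t.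
  rewrite /sqdist big_ord_recl !tnth0; congr (_ + _).
  by apply: eq_bigr => i _; rewrite !tnthS.
under eq_integral => y _.
  under eq_integral => t _.
    rewrite /tcons/= sqnormS sqdistS.
    rewrite (_ : - _ = - (y ^+ 2 + s * (x0 - y) ^+ 2) +
      - (sqnorm t + s * sqdist x t)); last by ring.
    rewrite expRD EFinM.
    over.
  rewrite ge0_integralZl_EFin ?expR_ge0//; last exact: mE.
  rewrite [X in (_ * X)%E]IHn.
  over.
rewrite ge0_integralZr//; last first.
  apply/measurable_EFinP; apply: measurableT_comp => //.
  apply: measurable_funN; apply: measurable_funD; first exact: measurable_funX.
  by apply: measurable_funM => //; apply: measurable_funX; exact: measurable_funB.
rewrite integral_gauss_mul// -EFinM; congr EFin.
rewrite sqnormS mulrACA -exprS; congr (_ * _).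
by rewrite -expRD; congr expR; ring.
Qed.

(** A single term (s q)^k / k! of the exponential series is at most exp(s q). *)
Lemma exprn_mul_expRN_le k s q : 0 < s -> 0 <= q ->
  q ^+ k * expR (- (s * q)) <= k`!%:R / s ^+ k.
Proof.
move=> s0 q0.
have sq0 : 0 <= s * q by rewrite mulr_ge0// ltW.
have : (s * q) ^+ k / k`!%:R <= expR (s * q).
  case: k => [|k]; first by rewrite expr0 divr1 (le_trans _ (expR_ge1Dx _))// lerDl.
  by rewrite (le_trans _ (expR_ge1Dxn k sq0))// lerDr.
rewrite ler_pdivrMr ?ltr0n ?fact_gt0// exprMn => h.
rewrite expRN ler_pdivlMr ?exprn_gt0// mulrAC ler_pdivrMr ?expR_gt0//.
by rewrite mulrC [leRHS]mulrC.
Qed.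

Definition moment_integrand n (x : n.-tuple R) k s (y : n.-tuple R) : R :=
  sqdist x y ^+ k * expR (- (sqnorm y + s * sqdist x y)).

Lemma moment_integrand_ge0 n (x : n.-tuple R) k s y :
  0 <= moment_integrand x k s y.
Proof. by rewrite mulr_ge0 ?exprn_ge0 ?sqdist_ge0 ?expR_ge0. Qed.

Lemma measurable_moment_integrand n (x : n.-tuple R) k s :
  measurable_fun [set: n.-tuple (measurableTypeR R)]
    (moment_integrand x k s).
Proof.
apply: measurable_funM.
  by apply: measurable_funX; exact: measurable_sqdist.
apply: measurableT_comp => //.
apply: measurable_funN; apply: measurable_funD; first exact: measurable_sqnorm.
by apply: measurable_funM => //; exact: measurable_sqdist.
Qed.

(** The bound is independent of s' and integrable in y: it is the domination used to differentiate
    in s. *)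
Lemma moment_integrand_le n (x : n.-tuple R) k s s' y : 0 < s -> s <= s' ->
  moment_integrand x k s' y <= k`!%:R / s ^+ k * expR (- sqnorm y).
Proof.
move=> s0 ss'; rewrite /moment_integrand opprD expRD mulrCA [leRHS]mulrC.
rewrite ler_pM2l ?expR_gt0// (le_trans _ (exprn_mul_expRN_le k s0 (sqdist_ge0 x y)))//.
rewrite ler_wpM2l ?exprn_ge0 ?sqdist_ge0// ler_expR lerN2.
by rewrite ler_wpM2r ?sqdist_ge0.
Qed.

Lemma integrable_gauss_Rn n : (lebesgue_measure_Rn R n).-integrable setT
  (fun y : n.-tuple R => (expR (- sqnorm y))%:E).
Proof.
(* The Gaussian is the case s = 0 of [integral_gauss_mul_Rn], with an arbitrary centre. *)
have h (y : n.-tuple R) : expR (- sqnorm y) =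
    expR (- (sqnorm y + 0 * sqdist [tuple 0 | i < n] y)).
  by rewrite mul0r addr0.
apply/integrableP; split.
  apply/measurable_EFinP; apply: measurableT_comp => //.
  apply: measurable_funN; exact: measurable_sqnorm.
under eq_integral do rewrite /= ger0_norm ?expR_ge0// h.
by rewrite integral_gauss_mul_Rn// ltry.
Qed.

Lemma integrable_moment_integrand n (x : n.-tuple R) k s : 0 < s ->
  (lebesgue_measure_Rn R n).-integrable setT (EFin \o moment_integrand x k s).
Proof.
move=> s0.
apply: (le_integrable _ _ _
  (integrableZl measurableT (k`!%:R / s ^+ k) (integrable_gauss_Rn n))) => //.
  apply/measurable_EFinP; exact: measurable_moment_integrand.
move=> y _; rewrite /= lee_fin !ger0_norm ?moment_integrand_ge0//.
  exact: moment_integrand_le.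
by rewrite mulr_ge0 ?expR_ge0// divr_ge0// exprn_ge0// ltW.
Qed.

Definition moment n (x : n.-tuple R) k s : R :=
  \int[lebesgue_measure_Rn R n]_y moment_integrand x k s y.

Lemma EFin_moment n (x : n.-tuple R) k s : 0 < s ->
  (\int[lebesgue_measure_Rn R n]_y (moment_integrand x k s y)%:E =
   (moment x k s)%:E)%E.
Proof.
by move=> s0; rewrite fineK//; apply: integrable_fin_num => //;
  exact: integrable_moment_integrand.
Qed.

(** Differentiating exp(- s r^2) in s brings down a factor - r^2, which raises k by one. *)
Lemma is_derive_moment n (x : n.-tuple R) k s : 0 < s ->
  is_derive s 1 (moment x k) (- moment x k.+1 s).
Proof.
move=> s0.
have dI (t : R) (y : n.-tuple R) : is_derive t 1 (fun t : R => moment_integrand x k t y)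
    (- moment_integrand x k.+1 t y).
  rewrite /moment_integrand.
  apply: is_derive_eq.
  rewrite /GRing.scale/= exprSr; ring.
(* The lower end s / 2 keeps the neighbourhood away from 0, where the dominating constant blows
   up. *)
have s2 : s / 2 < s < s + 1 by lra.
have sI : [set` `]s / 2, s + 1[] s by rewrite /= in_itv.
have intI t : [set` `]s / 2, s + 1[] t -> (lebesgue_measure_Rn R n).-integrable
    setT (EFin \o moment_integrand x k t).
  rewrite /= in_itv/= => /andP[st _]; apply: integrable_moment_integrand.
  lra.
pose G (y : n.-tuple R) := k.+1`!%:R / (s / 2) ^+ k.+1 * expR (- sqnorm y).
have G0 y : 0 <= G y.
  by rewrite mulr_ge0 ?expR_ge0// divr_ge0// exprn_ge0//; lra.
have intG : (lebesgue_measure_Rn R n).-integrable setT (EFin \o G).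
  rewrite (_ : _ \o _ = (fun y => (k.+1`!%:R / (s / 2) ^+ k.+1)%:E *
    (expR (- sqnorm y))%:E)%E); last by apply/funext => y /=; rewrite -EFinM.
  by apply: integrableZl => //; exact: integrable_gauss_Rn.
have derI (t : R) y : [set` `]s / 2, s + 1[] t -> [set: n.-tuple R] y ->
    derivable (fun t : R => moment_integrand x k t y) t 1.
  by move=> _ _; have [] := dI t y.
have dE t y : partial1of2 (moment_integrand x k) t y =
    - moment_integrand x k.+1 t y.
  by rewrite partial1of2E; have [_ ->] := dI t y.
have Gub t y : [set` `]s / 2, s + 1[] t -> [set: n.-tuple R] y ->
    `|partial1of2 (moment_integrand x k) t y| <= G y.
  rewrite /= in_itv/= => /andP[st _] _.
  rewrite dE normrN ger0_norm ?moment_integrand_ge0//.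
  by apply: moment_integrand_le; lra.
have mT : measurable [set: n.-tuple (measurableTypeR R)] by [].
apply: DeriveDef.
  exact: (@derivable_under_integral _ _ _ (lebesgue_measure_Rn R n)
    (moment_integrand x k) setT mT s (s / 2) (s + 1) sI intI derI G G0 intG Gub).
rewrite -derive1E.
rewrite [LHS](@differentiation_under_integral _ _ _ (lebesgue_measure_Rn R n)
    (moment_integrand x k) setT mT s (s / 2) (s + 1) sI intI derI G G0 intG Gub).
under eq_Rintegral do rewrite dE -mulN1r.
rewrite RintegralZl ?mulN1r//.
exact: integrable_moment_integrand.
Qed.

(** For 1 + s > 0 this is (1 + s)^(-c) exp(- z s / (1 + s)), written as a single exponential for
    ease of differentiation. *)
Definition damping (c z s : R) : R :=
  expR (- (c * ln (1 + s) + z * (s / (1 + s)))).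

Lemma moment0E n (x : n.-tuple R) s : 0 < s ->
  moment x 0 s = pi `^ (n%:R / 2) * damping (n%:R / 2) (sqnorm x) s.
Proof.
move=> s0; have s1 : 0 < 1 + s by lra.
rewrite /moment /Rintegral.
under eq_integral do rewrite /moment_integrand expr0 mul1r.
rewrite integral_gauss_mul_Rn ?ltW//=.
rewrite -powR_mulrn ?sqrtr_ge0// -powR12_sqrt; last by rewrite divr_ge0// ?pi_ge0 ?ltW.
rewrite -powRrM [2^-1 * _]mulrC powRM ?pi_ge0 ?invr_ge0 ?ltW//.
rewrite -[LHS]mulrA; congr (_ * _).
rewrite /powR gt_eqF ?invr_gt0// lnV ?posrE// -expRD; congr expR.
by field; rewrite gt_eqF.
Qed.

Lemma is_derive_damping (c z s : R) : 0 < s ->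
  is_derive s 1 (damping c z)
    (- ((c * (1 + s)^-1 + z * (1 + s)^-1 ^+ 2) * damping c z s)).
Proof.
move=> s0; have s1 : 0 < 1 + s by lra.
have s1' : 1 + s != 0 by rewrite gt_eqF.
have dL : is_derive s 1 (fun s : R => ln (1 + s)) (1 + s)^-1.
  have dl := is_derive1_ln s1.
  by apply: is_derive_eq; rewrite /GRing.scale/=; ring.
have dV : is_derive s 1 (fun s : R => s / (1 + s)) ((1 + s)^-1 ^+ 2).
  apply: is_derive_eq; rewrite /GRing.scale/=; field.
  done.
rewrite /damping.
by apply: is_derive_eq; rewrite /GRing.scale/=; ring.
Qed.

(** Passes a closed form from M_k to M_(k+1). The formula is assumed for positive t only, hence near
    s, which is all that a derivative sees. *)
Lemma moment_derive n (x : n.-tuple R) k (g : R -> R) (dg s : R) :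
  (forall t, 0 < t -> moment x k t = g t) -> 0 < s -> is_derive s 1 g dg ->
  moment x k.+1 s = - dg.
Proof.
move=> gE s0 [_ <-]; have [_ h] := is_derive_moment x k s0.
rewrite -[LHS]opprK -h; congr (- _).
apply: near_eq_derive => //.
near=> t; apply: gE; near: t; exact: lt_nbhsr.
Unshelve. all: by end_near. Qed.

Lemma moment1E n (x : n.-tuple R) s : 0 < s ->
  moment x 1 s = pi `^ (n%:R / 2) *
    ((n%:R / 2 * (1 + s)^-1 + sqnorm x * (1 + s)^-1 ^+ 2) *
     damping (n%:R / 2) (sqnorm x) s).
Proof.
move=> s0.
have dd := is_derive_damping (n%:R / 2) (sqnorm x) s0.
rewrite (moment_derive (@moment0E n x) s0 (is_deriveZ _ dd)).
by rewrite /GRing.scale/= mulrN opprK.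
Qed.

(** The derivative of [moment1E]. A factor (1 + s)^-2 comes out of every term and leaves a quadratic
    in (1 + s)^-1. *)
Lemma moment2E n (x : n.-tuple R) s (c := n%:R / 2) (z := sqnorm x) : 0 < s ->
  moment x 2 s = pi `^ c * (damping c z s * (1 + s)^-1 ^+ 2 *
    (c * (c + 1) + 2 * z * (c + 1) * (1 + s)^-1 + z ^+ 2 * (1 + s)^-1 ^+ 2)).
Proof.
move=> s0; have s1' : 1 + s != 0 by rewrite gt_eqF//; lra.
have dd := is_derive_damping c z s0.
have dV : is_derive s 1 (fun s : R => (1 + s)^-1) (- (1 + s)^-1 ^+ 2).
  by apply: is_derive_eq; rewrite /GRing.scale/=; field.
have dg : is_derive s 1
  (fun s : R => pi `^ c * ((c * (1 + s)^-1 + z * (1 + s)^-1 ^+ 2) *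
     damping c z s)) (- (pi `^ c * (damping c z s * (1 + s)^-1 ^+ 2 *
    (c * (c + 1) + 2 * z * (c + 1) * (1 + s)^-1 + z ^+ 2 * (1 + s)^-1 ^+ 2)))).
  by apply: is_derive_eq; rewrite /GRing.scale/=; ring.
by rewrite (moment_derive (@moment1E n x) s0 dg) opprK.
Qed.

End gaussian_moments.

(** * Beta integrals on the half-line in the variable u = s / (1 + s) *)

Section beta_integrals.
Context (R : realType).
Implicit Types (a p s : R).
Local Notation mu := (@lebesgue_measure R).

(** The variable u, which maps [0, +oo[ onto [0, 1[, with 1 - u = (1 + s)^-1 and du = (1 + s)^-2
    ds. *)
Definition compactify s : R := s / (1 + s).

Lemma compactify_ge0 s : 0 <= s -> 0 <= compactify s.
Proof. by move=> s0; rewrite divr_ge0//; lra. Qed.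

Lemma compactify_gt0 s : 0 < s -> 0 < compactify s.
Proof. by move=> s0; rewrite divr_gt0//; lra. Qed.

Lemma compactify_le1 s : 0 <= s -> compactify s <= 1.
Proof. by move=> s0; rewrite ler_pdivrMr; lra. Qed.

Lemma compactify_le s : 0 <= s -> compactify s <= s.
Proof. by move=> s0; rewrite ler_pdivrMr; nra. Qed.

Lemma compactifyE s : 0 <= s -> compactify s = 1 - (1 + s)^-1.
Proof. by move=> s0; rewrite /compactify; field; rewrite gt_eqF//; lra. Qed.

Lemma is_derive_compactify s : 0 <= s ->
  is_derive s 1 compactify ((1 + s)^-1 ^+ 2).
Proof.
move=> s0; have s1 : 1 + s != 0 by rewrite gt_eqF//; lra.
by apply: is_derive_eq; rewrite /GRing.scale/=; field.
Qed.

Lemma is_derive_oneDV2 s : 0 <= s ->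
  is_derive s 1 (fun s : R => (1 + s)^-1 ^+ 2) (- 2 * (1 + s)^-1 ^+ 3).
Proof.
move=> s0; have s1 : 1 + s != 0 by rewrite gt_eqF//; lra.
by apply: is_derive_eq; rewrite /GRing.scale/=; field.
Qed.

Lemma is_derive_powR_compactify p s : 0 < s ->
  is_derive s 1 (fun s => compactify s `^ p)
    (p * compactify s `^ (p - 1) * (1 + s)^-1 ^+ 2).
Proof.
move=> s0; have u0 := compactify_gt0 s0.
have d1 := is_derive_compactify (ltW s0).
exact: (is_derive1_comp (f := @powR R ^~ p) (is_derive1_powR p u0) d1).
Qed.

Lemma powR_compactify_cvg0 p : 0 < p ->
  compactify s `^ p @[s --> 0^'+] --> (0 : R).
Proof.
move=> p0; apply: (@squeeze_cvgr _ _ _ _ (cst 0) (fun s => s `^ p)).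
- near=> s; have s0 : 0 < s by near: s; exact: nbhs_right_gt.
  rewrite powR_ge0/=; apply: ge0_ler_powR; rewrite ?nnegrE; first exact: ltW.
  + exact/compactify_ge0/ltW.
  + exact: ltW.
  + exact/compactify_le/ltW.
- exact: cvg_cst.
- exact: powR_cvg0.
Unshelve. all: by end_near. Qed.

Lemma compactify_cvg1 : compactify s @[s --> +oo] --> (1 : R).
Proof.
have h : 1 - (1 + s)^-1 @[s --> +oo] --> (1 - 0 : R).
  apply: cvgB; first exact: cvg_cst.
  apply/gtr0_cvgV0.
    by near=> s; rewrite ltr_pwDl//; near: s; exact: (nbhs_pinfty_ge (num_real _)).
  apply/cvgryPge => A; near=> s.
  have : A <= s by near: s; exact: (nbhs_pinfty_ge (num_real _)).
  lra.
rewrite subr0 in h; apply: cvg_trans h.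
apply: near_eq_cvg; near=> s; have s0 : 0 <= s by near: s; exact: (nbhs_pinfty_ge (num_real _)).
by rewrite compactifyE.
Unshelve. all: by end_near. Qed.

Lemma continuous_powR_compactify p s : 0 < s ->
  {for s, continuous (fun s => compactify s `^ p * (1 + s)^-1 ^+ 2)}.
Proof.
move=> s0; apply/differentiable_continuous; rewrite -derivable1_diffP.
have d1 := is_derive_powR_compactify p s0.
have d2 := is_derive_oneDV2 (ltW s0).
by have [] := is_deriveM d1 d2.
Qed.

Lemma measurable_powR_compactify p :
  measurable_fun (`]0, +oo[ : set R) (fun s => compactify s `^ p * (1 + s)^-1 ^+ 2).
Proof.
apply: open_continuous_measurable_fun => //.
by move=> s; rewrite inE/= in_itv/= andbT => /continuous_powR_compactify; exact.
Qed.

(** The integrand is u^p du, with primitive u^(p+1) / (p+1) going from 0 at s = 0 to 1 / (p+1) at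
    infinity. As p > 0, it is continuous at 0, as the fundamental theorem on the closed half-line
    requires. *)
Lemma integral_powR_compactify p : 0 < p ->
  (\int[mu]_(s in `]0%R, +oo[) (compactify s `^ p * (1 + s)^-1 ^+ 2)%:E =
   ((p + 1)^-1)%:E)%E.
Proof.
move=> p0.
have p1 : p + 1 != 0 by rewrite gt_eqF//; lra.
pose F s : R := (p + 1)^-1 * compactify s `^ (p + 1).
have dF s : 0 < s -> is_derive s 1 F (compactify s `^ p * (1 + s)^-1 ^+ 2).
  move=> s0; have d1 := is_derive_powR_compactify (p + 1) s0.
  apply: (is_derive_eq (is_deriveZ (p + 1)^-1 d1)).
  by rewrite /GRing.scale/= addrK !mulrA mulVf// mul1r.
have F0 : F 0 = 0 by rewrite /F /compactify mul0r powR0// mulr0.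
rewrite integral_itv_obnd_cbnd; last first.
  by apply/measurable_EFinP; exact: measurable_powR_compactify.
rewrite (@ge0_continuous_FTC2y _ _ F _ (p + 1)^-1).
- by rewrite F0 sube0.
- by move=> s s0; rewrite mulr_ge0 ?powR_ge0// exprn_ge0// invr_ge0; lra.
- apply/continuous_within_itvcyP; split.
    by move=> s; rewrite in_itv/= andbT => /continuous_powR_compactify; exact.
  rewrite [X in _ --> X](_ : _ = 0 * (1 + 0)^-1 ^+ 2); last first.
    by rewrite {1}/compactify mul0r powR0 ?gt_eqF.
  apply: cvgM; first exact: powR_compactify_cvg0.
  apply: cvg_at_right_filter.
  suff : {for 0 : R, continuous (fun s : R => (1 + s)^-1 ^+ 2)} by [].
  apply/differentiable_continuous; rewrite -derivable1_diffP.
  by have [] := is_derive_oneDV2 (lexx 0).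
- rewrite -[X in _ --> X]mulr1; apply: cvgM; first exact: cvg_cst.
  have p1E : (1 : R) `^ (p + 1) = 1 by rewrite powR1.
  rewrite -[X in _ --> X]p1E.
  apply: (@cvg_comp _ _ _ _ (fun u : R => u `^ (p + 1)) _ _ _ compactify_cvg1).
  suff : {for 1 : R, continuous (fun u : R => u `^ (p + 1))} by [].
  apply/differentiable_continuous; rewrite -derivable1_diffP.
  by have [] := is_derive1_powR (p + 1) (@ltr01 R).
- by move=> s /dF [].
- rewrite F0 -[X in _ --> X](mulr0 (p + 1)^-1).
  by apply: cvgM; [exact: cvg_cst|apply: powR_compactify_cvg0; lra].
- by move=> s; rewrite in_itv/= andbT => /dF; rewrite derive1E => -[_ ->].
Qed.

(** A real-valued integral does not record integrability, which linearity needs; hence the pair. *)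
Definition has_Rintegral (f : R -> R) (v : R) :=
  mu.-integrable `]0, +oo[ (EFin \o f) /\ \int[mu]_(s in `]0, +oo[) f s = v.

Lemma has_Rintegral_eq f g v : (forall s, 0 < s -> f s = g s) ->
  has_Rintegral f v -> has_Rintegral g v.
Proof.
move=> fg [intf <-]; split.
  apply: eq_integrable intf => // s; rewrite inE/= in_itv/= andbT => s0.
  by rewrite fg.
apply: eq_Rintegral => s; rewrite inE/= in_itv/= andbT => s0.
by rewrite fg.
Qed.

Lemma has_RintegralD f g v w : has_Rintegral f v -> has_Rintegral g w ->
  has_Rintegral (fun s => f s + g s) (v + w).
Proof.
move=> [intf <-] [intg <-]; split; last by rewrite RintegralD.
by rewrite [X in _.-integrable _ X](_ : _ = (EFin \o f) \+ (EFin \o g))%E//;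
  exact: integrableD.
Qed.

Lemma has_RintegralZ k f v : has_Rintegral f v ->
  has_Rintegral (fun s => k * f s) (k * v).
Proof.
move=> [intf <-]; split; last by rewrite RintegralZl.
rewrite [X in _.-integrable _ X](_ : _ = (fun s => k%:E * (EFin \o f) s))%E//.
exact: integrableZl.
Qed.

(** This is u^(a+k) (1-u)^m du: two of the m + 2 factors are the Jacobian. The integer exponent k is
    kept apart from the real one so that [ring] and [field] can treat it. *)
Definition bweight a k m s : R :=
  compactify s `^ a * compactify s ^+ k * (1 + s)^-1 ^+ m.+2.

(* [beta p m] is Euler's B(p, m + 1); the recursion comes from
   (1 - u)^(m + 1) = (1 - u)^m - u (1 - u)^m. *)
Fixpoint beta p m : R :=
  if m is m'.+1 then beta p m' - beta (p + 1) m' else p^-1.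

(** Induction on m for all k at once, since the recursion of [beta] raises k; the base case is
    [integral_powR_compactify]. *)
Lemma has_Rintegral_bweight a k m : 0 < a ->
  has_Rintegral (bweight a k m) (beta (a + 1 + k%:R) m).
Proof.
move=> a0; elim: m k => [|m IHm] k.
  have ak0 : 0 < a + k%:R by rewrite ltr_wpDr.
  apply: (@has_Rintegral_eq
      (fun s => compactify s `^ (a + k%:R) * (1 + s)^-1 ^+ 2)).
    move=> s s0; rewrite /bweight powRD; last first.
      by rewrite gt_eqF ?compactify_gt0// implybT.
    by rewrite powR_mulrn// compactify_ge0// ltW.
  have iE := integral_powR_compactify ak0.
  split; last by rewrite /Rintegral iE/= addrAC.
  apply/integrableP; split.
    by apply/measurable_EFinP; exact: measurable_powR_compactify.
  rewrite [ltLHS](_ : _ = (a + k%:R + 1)^-1%:E) ?ltry// -iE.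
  apply: eq_integral => s; rewrite inE/= in_itv/= andbT => s0.
  rewrite ger0_norm// mulr_ge0 ?powR_ge0// exprn_ge0// invr_ge0; lra.
have := has_RintegralD (IHm k) (has_RintegralZ (-1) (IHm k.+1)).
rewrite mulN1r -natr1 addrA; apply: has_Rintegral_eq => s s0.
rewrite /bweight [compactify s ^+ k.+1]exprSr compactifyE ?ltW// [in RHS]exprSr.
by ring.
Qed.

Lemma series_at0 (u : R^nat) : series u 0%N = 0.
Proof. by rewrite seriesEnat/= big_geq. Qed.

(** Termwise comparison with the series at y, whose partial sums increase to [expR y]. The bound is
    uniform in N, as domination requires. *)
Lemma norm_series_exp_coeff_le (x y : R) N : `|x| <= y ->
  `|series (exp_coeff x) N| <= expR y.
Proof.
move=> xy; have y0 : 0 <= y by rewrite (le_trans _ xy).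
apply: (@le_trans _ _ (series (exp_coeff y) N)).
  rewrite !seriesEnat/=; apply: le_trans (ler_norm_sum _ _ _) _.
  apply: ler_sum => i _; rewrite /exp_coeff/= normrM normrX [X in _ * X]ger0_norm ?invr_ge0//.
  by rewrite ler_wpM2r ?invr_ge0// lerXn2r ?nnegrE.
apply: nondecreasing_cvgn_le; last exact: is_cvg_series_exp_coeff.
apply/nondecreasing_seqP => k; rewrite seriesSr lerDl.
by rewrite divr_ge0// exprn_ge0.
Qed.

(** * Termwise integration to the Kummer series *)

Definition kummer_coeff (a c z : R) k : R :=
  pochhammer a k / pochhammer c k * (z ^+ k / k`!%:R).

Lemma pochhammerS (a : R) k : pochhammer a k.+1 = pochhammer a k * (a + k%:R).
Proof. by rewrite /pochhammer big_ord_recr. Qed.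

(** Numerator and denominator share the factor c (c+1) ... (c+k-1), which cancels. *)
Lemma pochhammer_ratio (c : R) k : 0 < c ->
  pochhammer (c - 2) k.+2 / pochhammer c k.+2 =
  (c - 2) * (c - 1) / ((c + k%:R) * (c + k%:R + 1)).
Proof.
move=> c0; elim: k => [|k IHk].
  rewrite !pochhammerS /pochhammer !big_ord0; field.
  by rewrite !gt_eqF//; lra.
have k0 : 0 <= k%:R :> R by [].
rewrite (pochhammerS _ k.+2) (pochhammerS c k.+2) invfM mulrACA IHk.
rewrite -!natr1; field; rewrite !gt_eqF//; lra.
Qed.

Section kummer_integral.
Variables c z : R.
Hypothesis c1 : 1 < c.
Hypothesis z0 : 0 <= z.

Let a0 : 0 < c - 1. Proof. by rewrite subr_gt0. Qed.

(** Up to the factor pi^c this is s^(c-1) M_2(s), for c = n/2 and z = |x|^2. *)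
Definition kummer_integrand s : R :=
  bweight (c - 1) 0 1 s * expR (- (z * compactify s)) *
  (c * (c + 1) + 2 * z * (c + 1) * (1 + s)^-1 + z ^+ 2 * (1 + s)^-1 ^+ 2).

(* The partial sums have different lengths because their prefactors contain
   different powers of z: this makes the integral of the N-th approximant
   exactly a partial sum of the Kummer series. *)
Definition kummer_approx N s : R :=
  bweight (c - 1) 0 1 s * (c * (c + 1) *
      series (exp_coeff (- (z * compactify s))) N.+2 +
    2 * z * (c + 1) * (1 + s)^-1 *
      series (exp_coeff (- (z * compactify s))) N.+1 +
    z ^+ 2 * (1 + s)^-1 ^+ 2 * series (exp_coeff (- (z * compactify s))) N).

(** Passing from N to N + 1 adds one term to each of the three exponential sums, all of degree N + 2
    in z with their prefactors. Their beta integrals add up to the Kummer term of index N + 2. *)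
Lemma has_Rintegral_kummer_approx N : has_Rintegral (kummer_approx N)
  (series (kummer_coeff (c - 2) c (- z)) N.+2).
Proof.
have c0 : 0 < c by exact: lt_trans c1.
elim: N => [|N IHN].
  (* For N = 0 the sums have 2, 1 and 0 terms; the three beta integrals give the Kummer terms of
     index 0 and 1. *)
  have := has_RintegralD
    (has_RintegralD (has_RintegralZ (c * (c + 1)) (has_Rintegral_bweight 0 1 a0))
      (has_RintegralZ (- z * (c * (c + 1))) (has_Rintegral_bweight 1 1 a0)))
    (has_RintegralZ (2 * z * (c + 1)) (has_Rintegral_bweight 0 2 a0)).
  rewrite subrK [X in has_Rintegral _ X](_ : _ =
    series (kummer_coeff (c - 2) c (- z)) 2%N); last first.
    rewrite 2!seriesSr series_at0 /kummer_coeff.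
    rewrite !pochhammerS /pochhammer !big_ord0/= !factS fact0.
    by field; rewrite !gt_eqF//; lra.
  apply: has_Rintegral_eq => s s0.
  rewrite /kummer_approx !seriesSr series_at0 /exp_coeff/=.
  by rewrite /bweight !factS fact0; field; rewrite gt_eqF//; lra.
have N0 : 0 <= N%:R :> R by [].
have F0 : N`!%:R != 0 :> R by rewrite gt_eqF// ltr0n fact_gt0.
have N1 : (N.+1)%:R = 1 + N%:R :> R by rewrite -natr1 addrC.
have N2 : (N.+2)%:R = 2 + N%:R :> R by rewrite -!natr1; ring.
have := has_RintegralD IHN (has_RintegralD (has_RintegralD
    (has_RintegralZ (c * (c + 1) * ((- z) ^+ N.+2 / N.+2`!%:R))
      (has_Rintegral_bweight N.+2 1 a0))
    (has_RintegralZ (2 * z * (c + 1) * ((- z) ^+ N.+1 / N.+1`!%:R))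
      (has_Rintegral_bweight N.+1 2 a0)))
    (has_RintegralZ (z ^+ 2 * ((- z) ^+ N / N`!%:R))
      (has_Rintegral_bweight N 3 a0))).
rewrite subrK [X in has_Rintegral _ X](_ : _ =
    series (kummer_coeff (c - 2) c (- z)) N.+3); last first.
  rewrite [RHS]seriesSr; congr (_ + _).
  rewrite /kummer_coeff pochhammer_ratio// !factS !natrM N1 N2 /= !exprS.
  field; rewrite F0 !gt_eqF//; lra.
apply: has_Rintegral_eq => s s0; rewrite /kummer_approx.
rewrite (seriesSr _ N.+2) (seriesSr _ N.+1) (seriesSr _ N) /exp_coeff/= /bweight -!mulNr !exprMn.
rewrite !factS !natrM N1 N2 !exprS.
field; rewrite F0 !gt_eqF//; lra.
Qed.

(** Dominated convergence along [kummer_approx]: its integrals are partial sums of the Kummer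
    series, whose convergence is thus obtained as well. *)
Lemma has_Rintegral_kummer : has_Rintegral kummer_integrand
  (kummer (c - 2) c (- z)).
Proof.
have c0 : 0 < c by exact: lt_trans c1.
have v01 s : 0 < s -> 0 <= (1 + s)^-1 <= 1.
  by move=> s0; rewrite invr_ge0 invf_le1; lra.
have cc0 : 0 <= c * (c + 1) by rewrite mulr_ge0 ?addr_ge0// ltW.
have zc0 : 0 <= 2 * z * (c + 1) by rewrite mulr_ge0 ?addr_ge0 ?mulr_ge0// ltW.
(* Since 0 <= z u <= z, each exponential sum is at most exp(z) in absolute value; the powers of (1 +
   s)^-1 are at most 1. *)
pose C := expR z * (c * (c + 1) + 2 * z * (c + 1) + z ^+ 2).
have [intg _] := has_RintegralZ C (has_Rintegral_bweight 0 0 a0).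
have mapprox N : measurable_fun (`]0, +oo[ : set R)
    (EFin \o kummer_approx N).
  by have [/measurable_int] := has_Rintegral_kummer_approx N.
have cvg_series s : series (exp_coeff (- (z * compactify s))) N @[N --> \oo] -->
    expR (- (z * compactify s)) by exact: is_cvg_series_exp_coeff.
have approx_cvg s : (`]0, +oo[%classic : set R) s ->
    (EFin \o kummer_approx N) s @[N --> \oo] --> (EFin \o kummer_integrand) s.
  move=> _; apply: cvg_EFin; first exact: nearW.
  rewrite /comp/= /kummer_integrand -mulrA.
  apply: cvgM; first exact: cvg_cst.
  rewrite [X in _ --> X](_ : _ = c * (c + 1) * expR (- (z * compactify s)) +
    2 * z * (c + 1) * (1 + s)^-1 * expR (- (z * compactify s)) +
    z ^+ 2 * (1 + s)^-1 ^+ 2 * expR (- (z * compactify s))); last by ring.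
  apply: cvgD; last by apply: cvgM; [exact: cvg_cst|exact: cvg_series].
  apply: cvgD; (apply: cvgM; first exact: cvg_cst).
    by have := cvg_series s; rewrite -(cvg_shiftn 2); under eq_fun do rewrite addn2.
  by have := cvg_series s; rewrite -(cvg_shiftn 1); under eq_fun do rewrite addn1.
have approx_le N s : (`]0, +oo[%classic : set R) s ->
    (`|(EFin \o kummer_approx N) s| <= (C * bweight (c - 1) 0 0 s)%:E)%E.
  rewrite /= in_itv/= andbT => s0; rewrite lee_fin.
  have [v0 v1] := andP (v01 _ s0).
  have S_le M : `|series (exp_coeff (- (z * compactify s))) M| <= expR z.
    apply: norm_series_exp_coeff_le; rewrite normrN ger0_norm.
      by rewrite ler_piMr// compactify_le1// ltW.
    by rewrite mulr_ge0// compactify_ge0// ltW.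
  have w0 : 0 <= bweight (c - 1) 0 0 s.
    by rewrite !mulr_ge0 ?powR_ge0 ?exprn_ge0// ?compactify_ge0// ltW.
  rewrite /kummer_approx; set T := (X in _ * X).
  (* One factor (1 + s)^-1 of the weight is bounded by 1, so that the weight with m = 0
     dominates. *)
  rewrite (_ : _ * T = bweight (c - 1) 0 0 s * ((1 + s)^-1 * T)); last first.
    by rewrite /bweight; ring.
  rewrite normrM ger0_norm// [C * _]mulrC ler_wpM2l//.
  rewrite normrM ger0_norm// (le_trans (ler_piMl _ v1))// /T.
  rewrite (_ : C = expR z * (c * (c + 1)) + expR z * (2 * z * (c + 1)) +
    expR z * z ^+ 2); last by rewrite /C; ring.
  rewrite (le_trans (ler_normD _ _))//; apply: lerD.
    rewrite (le_trans (ler_normD _ _))//; apply: lerD.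
      by rewrite normrM ger0_norm// [leLHS]mulrC ler_wpM2r.
    rewrite normrM (ger0_norm (mulr_ge0 zc0 v0)) [leLHS]mulrC; apply: ler_pM => //.
      by rewrite mulr_ge0.
    by rewrite ler_piMr.
  have vv0 : 0 <= (1 + s)^-1 ^+ 2 by rewrite exprn_ge0.
  rewrite normrM (ger0_norm (mulr_ge0 (sqr_ge0 z) vv0)) [leLHS]mulrC; apply: ler_pM => //.
    by rewrite mulr_ge0 ?exprn_ge0.
  by rewrite ler_piMr ?exprn_ge0// exprn_ile1.
have mf : measurable_fun (`]0, +oo[ : set R) (EFin \o kummer_integrand).
  exact: (emeasurable_fun_cvg _ _ mapprox approx_cvg).
have [|||intf _ cvgi] := @dominated_convergence _ _ _ mu (`]0, +oo[ : set R)
    (measurable_itv _) (fun N => EFin \o kummer_approx N)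
    (EFin \o kummer_integrand)
    (fun s => (C * bweight (c - 1) 0 0 s)%:E) mapprox mf.
- by apply: aeW => s; exact: approx_cvg.
- exact: intg.
- by apply: aeW => s N; exact: approx_le.
split=> //; apply/esym.
have intE f v : has_Rintegral f v ->
    (\int[mu]_(s in `]0%R, +oo[) (f s)%:E = v%:E)%E.
  by move=> [fi <-]; rewrite fineK// integrable_fin_num.
suff : series (kummer_coeff (c - 2) c (- z)) N @[N --> \oo] -->
    \int[mu]_(s in `]0, +oo[) kummer_integrand s by move=> /cvg_lim; exact.
(* The N-th approximant integrates to the partial sum of N + 2 terms. *)
rewrite -(cvg_shiftn 2); under eq_fun do rewrite addn2.
suff /fine_cvg : (series (kummer_coeff (c - 2) c (- z)) N.+2)%:E
      @[N --> \oo] --> (\int[mu]_(s in `]0, +oo[) kummer_integrand s)%:E by [].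
rewrite fineK ?integrable_fin_num//.
move: cvgi; apply: cvg_trans; apply: near_eq_cvg; apply: nearW => N /=.
exact: intE (has_Rintegral_kummer_approx N).
Qed.

End kummer_integral.
End beta_integrals.

(** * Euler's integral *)

Section Gamma_integral.
Context (R : realType).
Implicit Types c q : R.
Local Notation mu := (@lebesgue_measure R).

Definition Gamma_integrand c (t : R) : R := t `^ (c - 1) * expR (- t).

Lemma Gamma_integrand_ge0 c t : 0 <= Gamma_integrand c t.
Proof. by rewrite mulr_ge0 ?powR_ge0 ?expR_ge0. Qed.

Lemma measurable_Gamma_integrand c : measurable_fun setT (Gamma_integrand c).
Proof.
by apply: measurable_funM => //; apply: measurableT_comp => //;
  exact: oppr_measurable.
Qed.

(** With t = u (1 + t) the integrand is u^(c-1) (1+t)^(c-1) exp(-t). As (1+t)^(c+1) exp(-t) is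
    bounded, a multiple of the weight u^(c-1) (1+t)^-2 dominates. *)
Lemma integrable_Gamma_integrand c : 1 < c ->
  mu.-integrable `]0, +oo[ (EFin \o Gamma_integrand c).
Proof.
(* An integer bound on c - 1 makes [exprn_mul_expRN_le] applicable; the factor e in [C] comes from
   exp(-t) = e exp(-(1 + t)). *)
move=> c1; pose m := Num.bound (c - 1).
have mP : c - 1 <= m%:R by apply/ltW/archi_boundP; lra.
pose C : R := m.+2`!%:R * expR 1.
have a0 : 0 < c - 1 by lra.
have [intg _] := has_RintegralZ C (has_Rintegral_bweight 0 0 a0).
apply: (le_integrable _ _ _ intg) => //.
  apply/measurable_EFinP; apply: measurable_funTS.
  exact: measurable_Gamma_integrand.
move=> t; rewrite /= in_itv/= andbT => t0; rewrite lee_fin.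
have t1 : 0 < 1 + t by lra.
have u0 := compactify_gt0 t0.
have tE : t = compactify t * (1 + t) by rewrite divfK// gt_eqF.
have h : (1 + t) `^ (c - 1) * (1 + t) ^+ 2 * expR (- t) <= C.
  apply: (@le_trans _ _ ((1 + t) ^+ m.+2 * expR (- t))).
    rewrite ler_wpM2r ?expR_ge0// -[m.+2]addn2 exprD ler_wpM2r ?exprn_ge0 ?(ltW t1)//.
    by rewrite -powR_mulrn ?(ltW t1)// ler_powR//; lra.
  rewrite (_ : - t = - (1 * (1 + t)) + 1); last by ring.
  rewrite expRD mulrA ler_wpM2r ?expR_ge0//.
  by have := exprn_mul_expRN_le m.+2 (@ltr01 R) (ltW t1); rewrite expr1n divr1.
rewrite ger0_norm ?Gamma_integrand_ge0// ger0_norm; last first.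
  by rewrite !mulr_ge0 ?powR_ge0 ?expR_ge0 ?exprn_ge0 ?invr_ge0 ?ltW.
rewrite /Gamma_integrand /bweight expr0 mulr1 {1}tE (powRM _ (ltW u0) (ltW t1)).
rewrite mulrCA -mulrA ler_wpM2l ?powR_ge0//.
by rewrite exprVn ler_pdivlMr ?exprn_gt0// mulrAC.
Qed.

Lemma EFin_Gamma c : 1 < c ->
  (\int[mu]_(t in `]0%R, +oo[) (Gamma_integrand c t)%:E = (Gamma c)%:E)%E.
Proof.
by move=> c1; rewrite fineK// integrable_fin_num//; exact: integrable_Gamma_integrand.
Qed.

(** On [1, 2] the integrand is at least exp(-2), since t^(c-1) >= 1 there. *)
Lemma Gamma_gt0 c : 1 < c -> 0 < Gamma c.
Proof.
move=> c1; rewrite -lte_fin -EFin_Gamma//.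
apply: (@lt_le_trans _ _ (\int[mu]_(t in `[1%R, 2%R]) (expR (- 2))%:E)%E).
  rewrite integral_cst//= lebesgue_measure_itv/= lte_fin ltr1n/= -EFinB -EFinM.
  by rewrite lte_fin mulr_gt0 ?expR_gt0//; lra.
apply: (@le_trans _ _
    (\int[mu]_(t in `[1%R, 2%R]) (Gamma_integrand c t)%:E)%E).
  apply: ge0_le_integral => //.
  - apply/measurable_EFinP; apply: measurable_funTS.
    exact: measurable_Gamma_integrand.
  - move=> t; rewrite /= in_itv/= => /andP[t1 t2]; rewrite lee_fin.
    rewrite -[leLHS]mul1r; apply: ler_pM; rewrite ?expR_ge0//.
      by rewrite -[leLHS](powRr0 t) ler_powR//; lra.
    by rewrite ler_expR lerN2.
apply: ge0_subset_integral => //.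
- apply/measurable_EFinP; apply: measurable_funTS.
  exact: measurable_Gamma_integrand.
- by move=> t _; rewrite lee_fin Gamma_integrand_ge0.
- by move=> t; rewrite /= !in_itv/= andbT => /andP[t1 _]; lra.
Qed.

(** The substitution t = q s in Euler's integral, to be used with q = r^2. *)
Lemma integral_Gamma_scale c q : 1 < c -> 0 < q ->
  (\int[mu]_(s in `]0%R, +oo[) (s `^ (c - 1) * expR (- (s * q)))%:E =
   (Gamma c / q `^ c)%:E)%E.
Proof.
move=> c1 q0.
(* Adding the endpoint, a null set, gives the closed half-line of the substitution rule. *)
have mI (f : R -> R) : measurable_fun setT f ->
    (\int[mu]_(s in `]0%R, +oo[) (f s)%:E =
     \int[mu]_(s in `[0%R, +oo[) (f s)%:E)%E.
  move=> mf; apply: integral_itv_obnd_cbnd.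
  by apply/measurable_EFinP; exact: measurable_funTS.
have mf : measurable_fun setT (fun s : R => s `^ (c - 1) * expR (- (s * q))).
  apply: measurable_funM => //; apply: measurableT_comp => //.
  by apply: measurable_funN; exact: measurable_funM.
have qc0 : q `^ c != 0 by rewrite gt_eqF// powR_gt0.
have FE : (fun s : R => q * s)^`()%classic = cst q.
  by apply/funext => s; rewrite derive1E deriveZ//= derive_id /GRing.scale/= mulr1.
have := EFin_Gamma c1; rewrite mI; last exact: measurable_Gamma_integrand.
rewrite -[X in `[X, +oo[](mulr0 q).
rewrite (@increasing_ge0_integration_by_substitutiony _ (fun s : R => q * s)).
- rewrite FE => h.
  rewrite EFinM muleC -h mI// -ge0_integralZl_EFin//.
  + apply: eq_integral => s; rewrite inE/= in_itv/= andbT => s0.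
    rewrite -EFinM; congr EFin; rewrite /Gamma_integrand fctE/= powRM ?(ltW q0)//.
    have -> : q `^ c = q `^ (c - 1) * q.
      by rewrite -{3}(powRr1 (ltW q0)) -powRD ?subrK// (gt_eqF q0) implybT.
    rewrite [s * q]mulrC; field.
    by rewrite !gt_eqF// powR_gt0.
  + move=> s; rewrite /= in_itv/= andbT => s0; rewrite lee_fin.
    by apply: mulr_ge0; [exact: Gamma_integrand_ge0|exact: ltW].
  + apply/measurable_EFinP; apply: measurable_funTS.
    apply: measurable_funM => //.
    apply: measurableT_comp; first exact: measurable_Gamma_integrand.
    exact: measurable_funM.
  + by rewrite invr_ge0 powR_ge0.
- by move=> s t _ _ st; rewrite ltr_pM2l.
- by rewrite FE => s _; exact: cvg_cst.
- by rewrite FE; exact: is_cvg_cst.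
- by rewrite FE; exact: is_cvg_cst.
- split; first by move=> s _; exact: derivableZ.
  by apply: cvg_at_right_filter; apply: cvgM; [exact: cvg_cst|exact: cvg_id].
- exact: gt0_cvgMry.
- rewrite mulr0; apply/continuous_within_itvcyP; split.
    move=> t; rewrite in_itv/= andbT => t0.
    apply: cvgM.
      suff : {for t, continuous (@powR R ^~ (c - 1))} by [].
      apply/differentiable_continuous; rewrite -derivable1_diffP.
      by have [] := is_derive1_powR (c - 1) t0.
    apply: continuous_comp; [exact: oppr_continuous|exact: continuous_expR].
  (* As c > 1, the integrand tends to 0 at 0, which is also its value there. *)
  rewrite {2}/Gamma_integrand powR0 ?mul0r; last by rewrite gt_eqF//; lra.
  rewrite -[X in _ --> X](mul0r (expR (- 0))); apply: cvgM.
    by apply: powR_cvg0; lra.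
  apply: cvg_at_right_filter.
  apply: continuous_comp; [exact: oppr_continuous|exact: continuous_expR].
- by move=> t _; exact: Gamma_integrand_ge0.
Qed.

End Gamma_integral.

(** * The potential of the Gaussian *)

Section potential.
Context (R : realType).
Implicit Types n : nat.
Local Notation mu := (@lebesgue_measure R).

(* For y = x both sides vanish, thanks to the convention 0^-1 = 0. *)
Lemma biharmonic_kernelE n (x y : n.-tuple R) : (3 <= n)%N -> n <> 4%N ->
  (\int[mu]_(s in `]0%R, +oo[)
    (s `^ (n%:R / 2 - 1) * moment_integrand x 2 s y)%:E =
   (Gamma (n%:R / 2) *
    (expR (- euclidean_norm y ^+ 2) / euclidean_dist x y ^ (n%:Z - 4)))%:E)%E.
Proof.
move=> n3 n4; set r := euclidean_dist x y; set c : R := n%:R / 2.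
have c1 : 1 < c by rewrite ltr_pdivlMr// mul1r ltr_nat.
have r0 : 0 <= r by exact: sqrtr_ge0.
rewrite sqr_euclidean_norm.
transitivity (\int[mu]_(s in `]0%R, +oo[)
    ((r ^+ 4 * expR (- sqnorm y))%:E *
     (s `^ (c - 1) * expR (- (s * r ^+ 2)))%:E))%E.
  apply: eq_integral => s _; rewrite -EFinM; congr EFin.
  rewrite /moment_integrand -sqr_euclidean_dist -/r opprD expRD.
  by ring.
have [rE|] := eqVneq r 0.
  rewrite rE expr0n/= mul0r; under eq_integral do rewrite mul0e.
  (* As n <> 4, the exponent n - 4 is nonzero, so the power of 0 is 0, even for the negative
     exponent at n = 3. *)
  rewrite integral0 exp0rz (_ : (n%:Z - 4 == 0) = false) ?invr0 ?mulr0//.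
  by apply/negbTE; rewrite subr_eq0; apply/eqP => -[].
move=> rn0; have rgt0 : 0 < r by rewrite lt_neqAle eq_sym rn0.
have q0 : 0 < r ^+ 2 by rewrite exprn_gt0.
rewrite ge0_integralZl_EFin//.
- rewrite integral_Gamma_scale// -EFinM; congr EFin.
  have -> : (r ^+ 2) `^ c = r ^+ n.
    rewrite -powR_mulrn// -powRrM -[RHS]powR_mulrn//; congr (_ `^ _).
    by rewrite /c; field.
  rewrite (_ : r ^ (n%:Z - 4) = r ^+ n / r ^+ 4); last by rewrite expfzDr.
  by rewrite invf_div; ring.
- by move=> s _; rewrite lee_fin mulr_ge0 ?powR_ge0 ?expR_ge0.
- apply/measurable_EFinP; apply: measurable_funTS; apply: measurable_funM => //.
  by apply: measurableT_comp => //; apply: measurable_funN; exact: measurable_funM.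
- by rewrite mulr_ge0 ?exprn_ge0 ?expR_ge0.
Qed.

(** The identity s^(c-1) (1+s)^(-c) = u^(c-1) (1+s)^-1, for c = n/2, turns the damping factor into
    the beta weight. *)
Lemma power_momentE n (x : n.-tuple R) s : 0 < s ->
  s `^ (n%:R / 2 - 1) * moment x 2 s =
  pi `^ (n%:R / 2) * kummer_integrand (n%:R / 2) (sqnorm x) s.
Proof.
move=> s0; rewrite moment2E//; set c := n%:R / 2; set z := sqnorm x.
have s1 : 0 < 1 + s by lra.
have h : s `^ (c - 1) * damping c z s =
    compactify s `^ (c - 1) * (1 + s)^-1 * expR (- (z * compactify s)).
  rewrite /damping opprD expRD mulrA; congr (_ * _).
  rewrite /compactify powRM ?invr_ge0 ?(ltW s0) ?(ltW s1)// -[RHS]mulrA.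
  congr (_ * _).
  have hv : (1 + s)^-1 = expR (- ln (1 + s)) by rewrite expRN lnK ?posrE.
  rewrite /powR gt_eqF ?invr_gt0// lnV ?posrE// [in RHS]hv -expRD.
  by congr expR; ring.
rewrite mulrCA /kummer_integrand /bweight expr0 mulr1; congr (_ * _).
transitivity ((s `^ (c - 1) * damping c z s) * ((1 + s)^-1 ^+ 2 *
  (c * (c + 1) + 2 * z * (c + 1) * (1 + s)^-1 + z ^+ 2 * (1 + s)^-1 ^+ 2))).
  by ring.
by rewrite h; ring.
Qed.

(** Gamma(c) times the integrand is an integral over s of a nonnegative function, so Tonelli's
    theorem exchanges the integrals, and finiteness comes with the value. *)
Lemma integral_biharmonic_kernel n (x : n.-tuple R) : (3 <= n)%N -> n <> 4%N ->
  (\int[lebesgue_measure_Rn R n]_y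
    (expR (- euclidean_norm y ^+ 2) / euclidean_dist x y ^ (n%:Z - 4))%:E =
   (pi `^ (n%:R / 2) / Gamma (n%:R / 2) *
    kummer (n%:R / 2 - 2) (n%:R / 2) (- sqnorm x))%:E)%E.
Proof.
move=> n3 n4; set c : R := n%:R / 2.
have c1 : 1 < c by rewrite ltr_pdivlMr// mul1r ltr_nat.
have G0 := Gamma_gt0 c1.
pose D : set R := `]0, +oo[%classic.
(* The indicator of the half-line extends the integrand in s to the full product space. *)
pose g (p : n.-tuple (measurableTypeR R) * measurableTypeR R) : \bar R :=
  (p.2 `^ (c - 1) * moment_integrand x 2 p.2 p.1 * \1_D p.2)%:E.
have gE y s : g (y, s) =
    ((fun s => (s `^ (c - 1) * moment_integrand x 2 s y)%:E) \_ D) s.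
  rewrite /g patchE/= indicE; case: ifP => _; first by rewrite mulr1.
  by rewrite mulr0.
have g_ge0 p : (0 <= g p)%E.
  by rewrite lee_fin indicE mulr_ge0// mulr_ge0 ?powR_ge0 ?moment_integrand_ge0.
have mg : measurable_fun setT g.
  have m1 : measurable_fun setT
      (fun p : n.-tuple (measurableTypeR R) * measurableTypeR R =>
        sqdist x p.1).
    exact: (measurableT_comp (measurable_sqdist x) measurable_fst).
  apply/measurable_EFinP; apply: measurable_funM; last first.
    have m2 : measurable_fun setT (\1_D : measurableTypeR R -> R).
      by apply: measurable_indic; exact: measurable_itv.
    exact: (measurableT_comp m2 measurable_snd).
  apply: measurable_funM.
    by apply: (measurableT_comp (measurable_powR (c - 1))).
  apply: measurable_funM; first exact: measurable_funX.
  apply: measurableT_comp => //; apply: measurable_funN.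
  apply: measurable_funD; last exact: measurable_funM.
  exact: (measurableT_comp (@measurable_sqnorm R n) measurable_fst).
have hE y : (Gamma c * (expR (- euclidean_norm y ^+ 2) /
    euclidean_dist x y ^ (n%:Z - 4)))%:E = (\int[mu]_s g (y, s))%E.
  rewrite -biharmonic_kernelE// integral_mkcond.
  by apply: eq_integral => s _; rewrite gE.
have GK : (\int[lebesgue_measure_Rn R n]_y (Gamma c *
    (expR (- euclidean_norm y ^+ 2) / euclidean_dist x y ^ (n%:Z - 4)))%:E =
    (pi `^ c * kummer (c - 2) c (- sqnorm x))%:E)%E.
  under eq_integral do rewrite hE.
  rewrite fubini_tonelli//.
  transitivity (\int[mu]_(s in `]0%R, +oo[)
      (pi `^ c * kummer_integrand c (sqnorm x) s)%:E)%E.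
    rewrite [RHS]integral_mkcond; apply: eq_integral => s _.
    rewrite patchE; case: ifPn => sD; last first.
      rewrite [LHS]integral0_eq// => y _.
      by rewrite gE patchE (negbTE sD).
    have s0 : 0 < s by move: sD; rewrite inE/= in_itv/= andbT.
    rewrite -power_momentE// EFinM -EFin_moment// -ge0_integralZl_EFin//.
    - by apply: eq_integral => y _; rewrite gE patchE sD.
    - by move=> y _; rewrite lee_fin moment_integrand_ge0.
    - by apply/measurable_EFinP; exact: measurable_moment_integrand.
    - exact: powR_ge0.
  have [intk <-] := has_RintegralZ (pi `^ c)
    (has_Rintegral_kummer c1 (sqnorm_ge0 x)).
  by rewrite fineK// integrable_fin_num.
transitivity (\int[lebesgue_measure_Rn R n]_y ((Gamma c)^-1%:E * (Gamma c *
    (expR (- euclidean_norm y ^+ 2) / euclidean_dist x y ^ (n%:Z - 4)))%:E))%E.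
  apply: eq_integral => y _; rewrite -EFinM mulKf// gt_eqF//.
rewrite ge0_integralZl_EFin//.
- by rewrite GK -EFinM; congr EFin; ring.
- by move=> y _; rewrite hE integral_ge0.
(* Measurability is inherited from the form of the function as a partial integral of [g]. *)
- under eq_fun do rewrite hE.
  exact: (measurable_fun_fubini_tonelli_F g mg).
- by rewrite invr_ge0 ltW.
Qed.

End potential.

Theorem theorem3p1 (R : realType) (n : nat) (n_ge3 : (3 <= n)%N)
    (n_neq4 : n <> 4%N) (x : n.-tuple R) :
  biharmonic_potential (fun y : n.-tuple R => expR (- euclidean_norm y ^+ 2)) x =
  (1 / (4 * (n%:R - 2) * (n%:R - 4)) *
   kummer ((n%:R - 4) / 2) (n%:R / 2) (- euclidean_norm x ^+ 2))%:E.
Proof.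
rewrite /biharmonic_potential integral_biharmonic_kernel// -EFinM; congr EFin.
have c1 : 1 < n%:R / 2 :> R by rewrite ltr_pdivlMr// mul1r ltr_nat.
have n2 : n%:R - 2 != 0 :> R.
  by rewrite subr_eq0 eqr_nat; apply/eqP => n2; rewrite n2 in n_ge3.
have n4 : n%:R - 4 != 0 :> R by rewrite subr_eq0 eqr_nat; apply/eqP.
rewrite sqr_euclidean_norm (_ : (n%:R - 4) / 2 = n%:R / 2 - 2 :> R); last by field.
(* The powers of pi and the values of Gamma cancel, being nonzero. *)
field; rewrite n2 n4 !gt_eqF ?Gamma_gt0 ?powR_gt0 ?pi_gt0//.
Qed.
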